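(* Let $\phi$ be a rational function with $\phi(\mathbb{D})\subseteq\mathbb{D}$ and let $W_{\phi,\psi}$ be a weighted composition operator on the disc with symbol $\phi$ and weight $\psi$. If $W_{\phi,\psi}$ is similar to an isometry on $H^p(\mathbb{D})$ for some $p$ with $1\le p<\infty$, then $\phi$ is inner.
   Context: $\mathbb{D}$ is the open unit disc, $\mathbb{T}$ the unit circle, and $m$ normalised Lebesgue measure on $\mathbb{T}$. For $1\le p<\infty$, $H^p(\mathbb{D})$ is the space of analytic functions $f$ on $\mathbb{D}$ with $\|f\|^p=\sup_{0<r<1}\int_{\mathbb{T}}|f(rt)|^p\,dm(t)<\infty$. For an analytic map $\phi:\mathbb{D}\to\mathbb{D}$ and an analytic function $\psi$ on $\mathbb{D}$, the weighted composition operator is $(W_{\phi,\psi}f)(z)=\psi(z)\,f(\phi(z))$; saying it is similar to an isometry on $H^p(\mathbb{D})$ includes the assertion that it maps $H^p(\mathbb{D})$ boundedly into itself. An isometry is a norm-preserving linear operator, not assumed surjective. A bounded operator $T$ on a Banach space $X$ is similar to an isometry if there are a bounded invertible operator $S$ on $X$ (with bounded inverse) and an isometry $U$ on $X$ such that $T=S^{-1}US$. An analytic map $\phi:\mathbb{D}\to\mathbb{D}$ is inner if its boundary values satisfy $|\phi(z)|=1$ for $m$-almost every $z\in\mathbb{T}$. *)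

(* Defs.v *)
From HB Require Import structures.
From mathcomp Require Import all_boot all_order all_algebra.
From mathcomp Require Import complex.
From mathcomp Require Import all_classical all_reals all_analysis.
From mathcomp Require Import measurable_realfun.

Set Implicit Arguments.
Unset Strict Implicit.
Unset Printing Implicit Defensive.

Import Order.TTheory GRing.Theory Num.Theory.
Import numFieldNormedType.Exports.

Local Open Scope classical_set_scope.
Local Open Scope ring_scope.
Local Open Scope complex_scope.

(* Complex topology and norm on R[i]; the library only provides them on R[i]^o. *)
HB.instance Definition _ (R : realType) := NormedModule.copy R[i] R[i]^o.

Section Disc.
Variable R : realType.
Implicit Types (f : R[i] -> R[i]) (p r t : R) (z : R[i]).

Definition unit_disc : set R[i] := [set z | `|z| < 1].

(* [derivable] over the field R[i]: complex differentiability. *)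
Definition analytic_on_disc f := forall z, unit_disc z -> derivable f z 1.

Definition disc_selfmap f := forall z, unit_disc z -> unit_disc (f z).

(* [f] agrees on the disc with a rational function without poles there; a
   rational function mapping the disc into itself has none in lowest terms.
   The values of [f] off the disc play no role. *)
Definition rational_on_disc f :=
  exists P Q : {poly R[i]},
    forall z, unit_disc z -> Q.[z] != 0 /\ f z = P.[z] / Q.[z].

Definition cis t : R[i] := cos t +i* sin t.

Lemma two_pi_gt0 : (0 : R) < 2 * pi.
Proof. by rewrite mulr_gt0// pi_gt0. Qed.

(* Normalised Lebesgue measure on the circle, read through t |-> exp(it), that
   is, as the uniform probability on [0, 2 * pi]. *)
Definition circle_measure := uniform_prob two_pi_gt0.

Definition hardy_mean p f r : \bar R :=
  \int[circle_measure]_t (Normc.normc (f (r%:C * cis t)) `^ p)%:E.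

Definition hardy_sup p f : \bar R :=
  ereal_sup [set hardy_mean p f r | r in `]0, 1[].

(* Boundary values are radial limits. *)
Definition inner f :=
  [/\ analytic_on_disc f, disc_selfmap f &
      {ae circle_measure, forall t,
        exists2 l : R[i], f (r%:C * cis t) @[r --> 1^'-] --> l & `|l| = 1}].

(* Elements of H^p are functions on the disc, extended by 0 so that equality of
   functions is equality on the disc. *)
Definition hardy_pred p (p1 : 1 <= p) : {pred R[i] -> R[i]} :=
  mem [set f | [/\ analytic_on_disc f,
                   forall z, ~ unit_disc z -> f z = 0 &
                   (hardy_sup p f < +oo)%E]].
End Disc.

Section lemmas.
Variable R : realType.
Implicit Types (f g : R[i] -> R[i]) (p r t : R) (z : R[i]).
Local Notation normc := Normc.normc.

Lemma normcE z : `|z| = (normc z)%:C. Proof. by case: z. Qed.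
Lemma normc_ge0 z : 0 <= normc z.
Proof. by case: z => a b; exact: sqrtr_ge0. Qed.
Lemma normcD z w : normc (z + w) <= normc z + normc w.
Proof. exact: le_normcD. Qed.

Lemma normcB_dist z w : `|normc z - normc w| <= normc (z - w).
Proof.
have H (u v : R[i]) : normc u - normc v <= normc (u - v).
  by rewrite lerBlDr; rewrite -{1}(subrK v u) normcD.
rewrite ler_norml H andbT lerNl opprB (le_trans (H _ _))//.
by rewrite -(normcN (z - w)) opprB.
Qed.

Lemma Rcvg_normc (T : Type) (F : set_system T) (FF : Filter F)
  (h : T -> R[i]) l :
  (normc (l - h x) @[x --> F] --> (0:R)) -> h x @[x --> F] --> l.
Proof.
move=> H; apply/cvgrPdist_lt => /= e e0.
have e0' : 0 < complex.Re e by move: e0; rewrite ltcE /= => /andP[].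
have eE : e = (complex.Re e)%:C by rewrite RRe_real// gtr0_real.
move/cvgrPdist_lt : H => /(_ _ e0'); apply: filterS => x.
by rewrite sub0r normrN ger0_norm ?normc_ge0// normcE {2}eE ltcR.
Qed.

Lemma cvg_Rnormc (T : Type) (F : set_system T) (FF : Filter F)
  (h : T -> R[i]) l :
  h x @[x --> F] --> l -> normc (h x) @[x --> F] --> normc l.
Proof.
move=> /cvgrPdist_lt H; apply/cvgrPdist_lt => /= e e0.
have : 0 < e%:C :> R[i] by rewrite ltcR.
move/H; apply: filterS => x; rewrite normcE ltcR; apply: le_lt_trans.
exact: normcB_dist.
Qed.

Lemma normc_le_ReIm (z : R[i]) :
  normc z <= `|complex.Re z| + `|complex.Im z|.
Proof.
case: z => a b /=; rewrite -(@ler_pXn2r _ 2)// ?nnegrE ?sqrtr_ge0 ?addr_ge0//.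
rewrite sqr_sqrtr ?addr_ge0 ?sqr_ge0// sqrrD !real_normK ?num_real//.
by rewrite lerD2r lerDl mulrn_wge0// mulr_ge0.
Qed.

Lemma cvg_complex (T : Type) (F : set_system T) (FF : Filter F)
  (h k : T -> R) a b :
  h x @[x --> F] --> a -> k x @[x --> F] --> b ->
  (h x +i* k x) @[x --> F] --> a +i* b.
Proof.
move=> ha kb; apply: Rcvg_normc.
apply: (@squeeze_cvgr _ _ _ _ (cst 0) (fun x => `|a - h x| + `|b - k x|)).
- apply: nearW => x; apply/andP; split; first exact: normc_ge0.
  exact: (le_trans (normc_le_ReIm _)).
- exact: cvg_cst.
- rewrite [X in _ --> X](_ : 0 = `|a - a| + `|b - b|); last first.
    by rewrite !subrr normr0 addr0.
  by apply: cvgD; apply: cvg_norm; apply: cvgB => //; exact: cvg_cst.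
Qed.

Lemma normc_cis t : normc (cis t) = 1.
Proof. by rewrite /cis /= cos2Dsin2 sqrtr1. Qed.

Lemma normcR r : 0 <= r -> normc r%:C = r.
Proof. by move=> r0; rewrite /= expr0n/= addr0 sqrtr_sqr ger0_norm. Qed.

Lemma unit_discE z : unit_disc z <-> normc z < 1.
Proof. by rewrite /unit_disc /= normcE ltcR. Qed.

Lemma disc_polar r t : 0 <= r < 1 -> unit_disc (r%:C * cis t).
Proof.
by move=> /andP[r0 r1]; apply/unit_discE; rewrite Normc.normcM normc_cis normcR// mulr1.
Qed.

Lemma analytic_cvg f z : analytic_on_disc f -> unit_disc z ->
  f x @[x --> z] --> f z.
Proof.
by move=> af /af /derivable1_diffP /differentiable_continuous.
Qed.

Lemma circle_cvg f r t : analytic_on_disc f -> 0 <= r < 1 ->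
  f (r%:C * cis x) @[x --> t] --> f (r%:C * cis t).
Proof.
move=> af r01; apply: (@cvg_comp _ _ _ (fun x => r%:C * cis x) f); last first.
  by apply: analytic_cvg => //; exact: disc_polar.
apply: cvgM; first exact: cvg_cst.
by apply: cvg_complex; [exact: continuous_cos|exact: continuous_sin].
Qed.

Lemma continuous_circle f r : analytic_on_disc f -> 0 <= r < 1 ->
  continuous (fun t => normc (f (r%:C * cis t))).
Proof.
by move=> af r01 t; apply: cvg_Rnormc; exact: circle_cvg.
Qed.

Lemma measurable_circle f r : analytic_on_disc f -> 0 <= r < 1 ->
  measurable_fun setT (fun t : R => normc (f (r%:C * cis t))).
Proof.
by move=> af r01; apply: continuous_measurable_fun; exact: continuous_circle.
Qed.

Lemma polar_surj z : exists r t, [/\ 0 <= r, 0 <= t <= 2 * pi & z = r%:C * cis t].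
Proof.
have [->|z0] := eqVneq z 0.
  exists 0, 0; split => //; last by rewrite mul0r.
  by rewrite lexx/= ltW// two_pi_gt0.
set r := normc z.
have r0 : r != 0 by apply: contra z0 => /eqP /Normc.eq0_normc ->.
have r_gt0 : 0 < r by rewrite lt_def r0 normc_ge0.
pose x := complex.Re z / r; pose y := complex.Im z / r.
have zE : z = r%:C * (x +i* y).
  rewrite /x /y; case: (z) => a b /=; simpc.
  by rewrite ![r * _]mulrC !divfK.
have xy : x ^+ 2 + y ^+ 2 = 1.
  have : normc (x +i* y) = 1.
    apply: (mulfI r0); rewrite mulr1 -{1}(normcR (ltW r_gt0)) -Normc.normcM -zE //.
  move=> /= /(congr1 (fun u => u ^+ 2)).
  by rewrite sqr_sqrtr ?addr_ge0 ?sqr_ge0// expr1n.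
have x1 : -1 <= x <= 1.
  rewrite -ler_norml -(@ler_pXn2r _ 2)// ?nnegrE//.
  by rewrite real_normK ?num_real// expr1n -xy lerDl sqr_ge0.
have yE : 1 - x ^+ 2 = y ^+ 2 by rewrite -xy addrAC subrr add0r.
have [y0|y0] := leP 0 y.
- exists r, (acos x); split; first exact: ltW.
    rewrite acos_ge0// (le_trans (acos_lepi x1))// mulr_natl mulr2n lerDl.
    exact/ltW/pi_gt0.
  by rewrite zE /cis acosK ?in_itv//= sin_acos// yE sqrtr_sqr ger0_norm.
- exists r, (2 * pi - acos x); split; first exact: ltW.
    rewrite lerBlDr lerDl acos_ge0// andbT subr_ge0.
    rewrite (le_trans (acos_lepi x1))// mulr_natl mulr2n lerDl.
    exact/ltW/pi_gt0.
  rewrite zE /cis cosB sinB mulr_natl cos2pi sin2pi !(mul0r, mul1r) addr0 sub0r.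
  by rewrite acosK ?in_itv//= sin_acos// yE sqrtr_sqr ltr0_norm ?opprK.
Qed.

Local Notation M := (fun (f : R[i] -> R[i]) (r t : R) => normc (f (r%:C * cis t)%R)).

Lemma hardy_mean_ge0 p f r : (0 <= hardy_mean p f r)%E.
Proof. by apply: integral_ge0 => t _; rewrite lee_fin powR_ge0. Qed.

Lemma hardy_mean_le_sup p f r : 0 < r < 1 -> (hardy_mean p f r <= hardy_sup p f)%E.
Proof. by move=> r01; apply: ereal_sup_ubound; exists r => //=; rewrite in_itv. Qed.

Lemma hardy_sup_ge0 p f : (0 <= hardy_sup p f)%E.
Proof.
apply: (le_trans (hardy_mean_ge0 p f 2^-1)); apply: hardy_mean_le_sup.
by rewrite invr_gt0 ltr0n/= invf_lt1 ?ltr1n.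
Qed.

Lemma measurable_mean p f r : analytic_on_disc f -> 0 <= r < 1 ->
  measurable_fun setT (fun t : R => (M f r t `^ p)%:E).
Proof.
move=> af r01; apply/measurable_EFinP.
apply: (@measurableT_comp _ _ _ _ _ _ (@powR R ^~ p)) => //.
exact: measurable_circle.
Qed.

Lemma hardy_meanE p f r : 0 < p ->
  (hardy_mean p f r `^ p^-1 =
   'N[@circle_measure R]_p%:E[EFin \o (M f r)])%E.
Proof.
move=> p0; rewrite unlock /Lnorm /hardy_mean; congr (_ `^ _)%E.
by apply: eq_integral => t _ /=; rewrite ger0_norm ?normc_ge0.
Qed.

Lemma hardy_mean_leP p f r (A : R) : 0 < p -> 0 <= A ->
  (hardy_mean p f r <= (A `^ p)%:E)%E <->
  ('N[@circle_measure R]_p%:E[EFin \o (M f r)] <= A%:E)%E.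
Proof.
move=> p0 A0; rewrite -hardy_meanE//; split => h.
- have : (hardy_mean p f r `^ p^-1 <= (A `^ p)%:E `^ p^-1)%E.
    by rewrite gt0_ler_poweR ?in_itv/= ?leey ?invr_ge0 ?(ltW p0)// ?andbT ?hardy_mean_ge0// lee_fin powR_ge0.
  by rewrite poweR_EFin -powRrM divff ?gt_eqF// powRr1.
- have : ((hardy_mean p f r `^ p^-1) `^ p <= A%:E `^ p)%E.
    by rewrite gt0_ler_poweR ?in_itv/= ?leey ?(ltW p0)// ?andbT ?poweR_ge0// lee_fin.
  by rewrite -poweRrM mulVf ?gt_eqF// poweRe1 ?hardy_mean_ge0.
Qed.

Lemma hardy_meanD p f g r (A B : R) : 1 <= p -> 0 <= r < 1 ->
  analytic_on_disc f -> analytic_on_disc g -> 0 <= A -> 0 <= B ->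
  (hardy_mean p f r <= (A `^ p)%:E)%E -> (hardy_mean p g r <= (B `^ p)%:E)%E ->
  (hardy_mean p (f + g)%R r <= ((A + B) `^ p)%:E)%E.
Proof.
move=> p1 r01 af ag A0 B0.
have p0 : 0 < p by rewrite (lt_le_trans ltr01).
move=> /(hardy_mean_leP _ _ p0 A0) fA /(hardy_mean_leP _ _ p0 B0) gB.
have : (\int[@circle_measure R]_t
   ((M f r t + M g r t) `^ p)%:E <= ((A + B) `^ p)%:E)%E.
  have := minkowski_EFin (@circle_measure R) (measurable_circle af r01) (measurable_circle ag r01) p1.
  move=> /le_trans /(_ (leeD fA gB)).
  rewrite unlock /Lnorm => h.
  have : ((\int[@circle_measure R]_t
   ((M f r t + M g r t) `^ p)%:E) `^ p^-1 <= (A + B)%:E)%E.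
    apply: le_trans h; rewrite le_eqVlt; apply/orP; left; apply/eqP; congr (_ `^ _)%E.
    by apply: eq_integral => t _ /=; rewrite ger0_norm ?addr_ge0 ?normc_ge0.
  set I := (\int[_]_t _)%E => h2.
  have I0 : (0 <= I)%E by apply: integral_ge0 => t _; rewrite lee_fin powR_ge0.
  have : ((I `^ p^-1) `^ p <= (A + B)%:E `^ p)%E.
    by rewrite gt0_ler_poweR ?in_itv/= ?leey ?(ltW p0)// ?andbT ?poweR_ge0// lee_fin addr_ge0.
  by rewrite -poweRrM mulVf ?gt_eqF// poweRe1.
have afg : analytic_on_disc (f + g)%R.
  by move=> z dz; apply: derivableD; [exact: af|exact: ag].
have mfg := @measurable_mean p (f + g)%R r afg r01.
apply: le_trans; apply: ge0_le_integral => //.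
- by move=> t _; rewrite lee_fin powR_ge0.
- apply/measurable_EFinP.
  apply: (@measurableT_comp _ _ _ _ _ _ (@powR R ^~ p)) => //.
  by apply: measurable_funD; exact: measurable_circle.
- move=> t _; rewrite lee_fin ge0_ler_powR ?nnegrE ?(ltW p0)// ?normc_ge0//.
  + by rewrite addr_ge0 ?normc_ge0.
  + exact: normcD.
Qed.

Lemma hardy_meanZ p f r (a : R[i]) : 0 < p -> 0 <= r < 1 -> analytic_on_disc f ->
  hardy_mean p (a *: f)%R r = ((normc a `^ p)%:E * hardy_mean p f r)%E.
Proof.
move=> p0 r01 af; rewrite -ge0_integralZl//.
- apply: eq_integral => t _; rewrite -EFinM -powRM ?normc_ge0//.
  by rewrite -Normc.normcM.
- exact: measurable_mean.
- by move=> t _; rewrite lee_fin powR_ge0.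
- by rewrite lee_fin powR_ge0.
Qed.

Lemma hardy_mean_eq0 p f r t : 0 < p -> 0 <= r < 1 -> analytic_on_disc f ->
  hardy_mean p f r = 0%E -> 0 <= t <= 2 * pi -> f (r%:C * cis t) = 0.
Proof.
move=> p0 r01 af h0 t02; apply: Normc.eq0_normc; apply/eqP/negPn/negP => Mt0.
have Mt : 0 < M f r t by rewrite lt_def Mt0 normc_ge0.
have mf := measurable_mean p af r01.
move: h0; rewrite /hardy_mean /circle_measure integral_uniform//; last first.
  by move=> x; rewrite lee_fin powR_ge0.
move/eqP; rewrite mule_eq0 eqe subr0 invr_eq0 (gt_eqF (two_pi_gt0 R))/= => /eqP h0.
have mD : measurable (`[0, 2 * pi]%classic : set R) by exact: measurable_itv.
have : ae_eq (@lebesgue_measure R) `[0, 2 * pi]%classic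
    (fun t : R => (M f r t `^ p)%:E) (cst 0%E).
  apply/ae_eq_integral_abs => //; first exact: measurable_funTS.
  rewrite -[RHS]h0; apply: eq_integral => x _.
  by rewrite gee0_abs// lee_fin powR_ge0.
case=> A [mA A0 sA].
have /cvgrPdist_lt/(_ _ Mt) := @continuous_circle f r af r01 t.
move=> /nbhs_ballP[d /= d0 hd].
have {}hd x : `|t - x| < d -> 0 < M f r x.
  move=> /hd h; rewrite -(subrK (M f r t) (M f r x)).
  rewrite -opprB addrC subr_gt0.
  exact: le_lt_trans (ler_norm _) h.
pose a := Num.max 0 (t - d / 2); pose b := Num.min (2 * pi) (t + d / 2).
have d20 : 0 < d / 2 by rewrite divr_gt0.
have d2d : d / 2 < d by rewrite ltr_pdivrMr// ltr_pMr// ltr1n.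
case/andP: t02 => t0 t2.
have ab : a < b.
  rewrite /a /b gt_max !lt_min (two_pi_gt0 R)/= (lt_le_trans d20) ?lerDr//.
  rewrite (lt_le_trans _ t2)/=; last by rewrite ltrBlDr ltrDl.
  by rewrite ltrBlDr -addrA ltrDl addr_gt0.
have abA : `[a, b]%classic `<=` A.
  move=> x; rewrite /= in_itv/= /a /b ge_max le_min.
  move=> /andP[/andP[x0 tx] /andP[x2 xt]]; apply: sA => /= h.
  have : (M f r x `^ p)%:E = 0%E :> \bar R by apply: h; rewrite /= in_itv/= x0.
  move=> [] /powR_eq0_eq0 /eqP; rewrite gt_eqF// hd//.
  apply: le_lt_trans d2d; rewrite ler_norml; apply/andP; split.
    by rewrite lerNl opprB lerBlDl.
  by rewrite lerBlDl -lerBlDr.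
have : ((lebesgue_measure (`[a, b]%classic : set R)) <= lebesgue_measure A)%E.
  by apply: le_measure => //; rewrite inE//; exact: measurable_itv.
rewrite A0 lebesgue_measure_itv/= lte_fin ab -EFinB lee_fin.
by rewrite leNgt subr_gt0 ab.
Qed.

Lemma hardy_sup_eq0 p f : 0 < p -> analytic_on_disc f ->
  hardy_sup p f = 0%E -> forall z, unit_disc z -> f z = 0.
Proof.
move=> p0 af h0.
have H z : unit_disc z -> z != 0 -> f z = 0.
  move=> dz z0; have [r [t [r0 t02 zE]]] := polar_surj z.
  have rz : normc z = r by rewrite zE Normc.normcM normc_cis normcR// mulr1.
  have r1 : r < 1 by rewrite -rz; apply/unit_discE.
  have rn0 : 0 < r.
    rewrite lt_def r0 andbT; apply: contra z0 => /eqP rE.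
    by rewrite zE rE mul0r.
  rewrite zE; apply: (@hardy_mean_eq0 p) => //; first by rewrite r0.
  apply/eqP; rewrite eq_le hardy_mean_ge0 andbT -h0.
  by apply: hardy_mean_le_sup; rewrite rn0.
move=> z dz; have [z0|] := eqVneq z 0; last exact: H.
have d0 : unit_disc (0 : R[i]) by rewrite /unit_disc/= normr0 ltr01.
rewrite {}z0 {z dz}.
have c1 : normc (f (r%:C * cis 0)) @[r --> (0:R)^'+] --> normc (f 0).
  apply: cvg_Rnormc.
  have c0 : r%:C * cis 0 @[r --> (0:R)^'+] --> (0 : R[i]).
    have -> : (0 : R[i]) = (0 +i* 0) * cis 0 by rewrite mul0r.
    apply: cvgM; last exact: cvg_cst.
    by apply: cvg_complex; [exact: cvg_within|exact: cvg_cst].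
  exact: (cvg_comp _ _ c0 (@analytic_cvg _ _ af d0)).
have c2 : normc (f (r%:C * cis 0)) @[r --> (0:R)^'+] --> (0 : R).
  apply: (cvg_trans _ (@cvg_cst _ (0:R) _ (0:R)^'+ _)).
  apply: near_eq_cvg; near=> r.
  rewrite H ?Normc.normc0//.
    apply: disc_polar; apply/andP; split; first by apply: ltW; near: r; exact: nbhs_right_gt.
    by near: r; apply: nbhs_right_lt.
  apply/eqP => /(congr1 (@normc R)); rewrite Normc.normcM normc_cis mulr1 normcR ?Normc.normc0.
    by move=> r0; have : 0 < r by []; rewrite r0 ltxx.
  by apply: ltW; near: r; exact: nbhs_right_gt.
by apply: Normc.eq0_normc; apply: (cvg_unique _ c1 c2).
Unshelve. all: by end_near. Qed.

End lemmas.

Section hardy_closed.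
Variables (R : realType) (p : R) (p1 : 1 <= p).
Implicit Types (f g : R[i] -> R[i]).

Let p0 : 0 < p. Proof. exact: lt_le_trans p1. Qed.

(* Only meaningful when [hardy_sup p f] is finite. *)
Definition hardy_norm f : R := fine (hardy_sup p f) `^ p^-1.

Lemma hardy_norm_ge0 f : 0 <= hardy_norm f. Proof. exact: powR_ge0. Qed.

Lemma hardy_sup_norm f : (hardy_sup p f < +oo)%E ->
  hardy_sup p f = (hardy_norm f `^ p)%:E.
Proof.
move=> f_fin; have f0 := hardy_sup_ge0 p f.
rewrite /hardy_norm -powRrM mulVf ?gt_eqF// powRr1 ?fine_ge0//.
by rewrite fineK// ge0_fin_numE.
Qed.

Lemma hardy_mean_norm f r : (hardy_sup p f < +oo)%E -> 0 < r < 1 ->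
  (hardy_mean p f r <= (hardy_norm f `^ p)%:E)%E.
Proof. by move=> ff r01; rewrite -hardy_sup_norm// hardy_mean_le_sup. Qed.

Lemma hardy_sup_le f (B : R) :
  (forall r, 0 < r < 1 -> (hardy_mean p f r <= B%:E)%E) ->
  (hardy_sup p f <= B%:E)%E.
Proof.
by move=> h; apply: ge_ereal_sup => y [r /=]; rewrite in_itv/= => r01 <-; exact: h.
Qed.

Lemma hardy_meanZ_le (a : R[i]) f r : analytic_on_disc f ->
  (hardy_sup p f < +oo)%E -> 0 < r < 1 ->
  (hardy_mean p (a *: f)%R r <= ((Normc.normc a * hardy_norm f) `^ p)%:E)%E.
Proof.
move=> af ff r01; have r01' : 0 <= r < 1 by case/andP: r01 => /ltW ->.
rewrite hardy_meanZ// powRM ?normc_ge0 ?hardy_norm_ge0// EFinM.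
by apply: lee_wpmul2l; [rewrite lee_fin powR_ge0|exact: hardy_mean_norm].
Qed.

Lemma hardy_norm_le f (B : R) : 0 <= B ->
  (forall r, 0 < r < 1 -> (hardy_mean p f r <= (B `^ p)%:E)%E) ->
  hardy_norm f <= B.
Proof.
move=> B0 /hardy_sup_le h.
have f_fin : (hardy_sup p f < +oo)%E by rewrite (le_lt_trans h)// ltry.
move: h; rewrite hardy_sup_norm// lee_fin => h.
rewrite leNgt; apply/negP => /(gt0_ltr_powR p0).
by rewrite !nnegrE hardy_norm_ge0 B0 => /(_ isT isT); rewrite ltNge h.
Qed.

Lemma hardy_predP f : reflect [/\ analytic_on_disc f,
    forall z, ~ unit_disc z -> f z = 0 & (hardy_sup p f < +oo)%E]
  (f \in hardy_pred p1).
Proof. by apply: (iffP idP); rewrite inE. Qed.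

Lemma hardy_submod_closed : submod_closed (hardy_pred p1).
Proof.
split.
  apply/hardy_predP; split => //.
  apply: (@le_lt_trans _ _ 0%:E); last exact: ltry.
  apply: hardy_sup_le => r _; rewrite /hardy_mean.
  rewrite integral0_eq// => t _.
  by rewrite (_ : (0 : R[i] -> R[i]) _ = 0)// Normc.normc0 powR0 ?gt_eqF.
move=> a f g /hardy_predP[af zf ff] /hardy_predP[ag zg fg]; apply/hardy_predP.
have aaf : analytic_on_disc (a *: f) by move=> z /af; exact: derivableZ.
split.
- by move=> z dz; apply: derivableD; [exact: aaf|exact: ag].
- by move=> z dz; rewrite /= {1}/GRing.add /= {1}/GRing.scale/= zf// zg// addr0 scaler0.
- apply: (@le_lt_trans _ _ ((Normc.normc a * hardy_norm f + hardy_norm g) `^ p)%:E);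
    last exact: ltry.
  apply: hardy_sup_le => r /andP[r0 r1].
  have r01 : 0 <= r < 1 by rewrite ltW.
  apply: (hardy_meanD p1 r01 aaf ag) => //.
  + by rewrite mulr_ge0 ?normc_ge0 ?hardy_norm_ge0.
  + exact: hardy_norm_ge0.
  + by apply: hardy_meanZ_le; rewrite ?r0.
  + by apply: hardy_mean_norm; rewrite ?r0.
Qed.
HB.instance Definition _ := GRing.isSubmodClosed.Build _ _ (hardy_pred p1)
  hardy_submod_closed.

Record Hp : predArgType :=
  MkHp { Hp_fun :> R[i] -> R[i]; _ : Hp_fun \in hardy_pred p1 }.

HB.instance Definition _ := [isSub for Hp_fun].
HB.instance Definition _ := [Choice of Hp by <:].
HB.instance Definition _ := [SubChoice_isSubLmodule of Hp by <:].

Lemma HpP (f : Hp) : (f : R[i] -> R[i]) \in hardy_pred p1.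
Proof. exact: valP. Qed.

Let nm (f : Hp) : R[i] := (hardy_norm f)%:C.

Let nmD (f g : Hp) : nm (f + g) <= nm f + nm g.
Proof.
have [/hardy_predP[af _ ff] /hardy_predP[ag _ fg]] := (HpP f, HpP g).
rewrite /nm -rmorphD lecR; apply: hardy_norm_le.
  by rewrite addr_ge0 ?hardy_norm_ge0.
move=> r r01; have r01' : 0 <= r < 1 by case/andP: r01 => /ltW ->.
apply: (hardy_meanD p1 r01' af ag); rewrite ?hardy_norm_ge0//;
  exact: hardy_mean_norm.
Qed.

Let nmZ_le (a : R[i]) (f : Hp) : nm (a *: f) <= `|a| * nm f.
Proof.
have /hardy_predP[af _ ff] := HpP f.
rewrite normcE /nm -rmorphM lecR; apply: hardy_norm_le.
  by rewrite mulr_ge0 ?normc_ge0 ?hardy_norm_ge0.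
by move=> r r01; exact: hardy_meanZ_le.
Qed.

Let nmZ (a : R[i]) (f : Hp) : nm (a *: f) = `|a| * nm f.
Proof.
apply/eqP; rewrite eq_le nmZ_le/=; have [->|a0] := eqVneq a 0.
  by rewrite normr0 mul0r lecR hardy_norm_ge0.
have aK : a^-1 *: (a *: f) = f by exact: scalerK.
rewrite -ler_pdivlMl ?normr_gt0// -normfV.
apply: le_trans (nmZ_le a^-1 (a *: f)).
rewrite aK.
exact: lexx.
Qed.

Let nm0_eq0 (f : Hp) : nm f = 0 -> f = 0.
Proof.
have /hardy_predP[af zf ff] := HpP f.
move=> [] f0; apply: val_inj; apply/funext => z /=.
have [dz|/zf ->//] := pselect (unit_disc z).
apply: (@hardy_sup_eq0 _ p) => //.
by rewrite hardy_sup_norm// f0 powR0 ?gt_eqF.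
Qed.

HB.instance Definition _ := Lmodule_isNormed.Build R[i] Hp nmD nmZ nm0_eq0.

Lemma Hp_normE (f : Hp) : `|f| = (hardy_norm f)%:C.
Proof. by []. Qed.
End hardy_closed.

Section similarity.
Variables (K : numFieldType) (X : normedModType K).
Implicit Types S T U : {linear X -> X}.

Definition bounded_operator T := exists M : K, forall x, `|T x| <= M * `|x|.

Definition isometry U := forall x, `|U x| = `|x|.

Definition similar_to_isometry T :=
  bounded_operator T /\
  exists S S' U : {linear X -> X},
    [/\ bounded_operator S, bounded_operator S' & cancel S S' /\ cancel S' S] /\
    isometry U /\ (forall x, T x = S' (U (S x))).
End similarity.

Definition weighted_comp (R : realType) (phi psi f : R[i] -> R[i]) (z : R[i]) :=
  psi z * f (phi z).

(* In particular [W_(phi, psi)] maps H^p into itself, and [T] is then unique. *)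
Definition wcomp_similar_to_isometry (R : realType) (p : R) (p1 : 1 <= p)
    (phi psi : R[i] -> R[i]) :=
  exists T : {linear Hp p1 -> Hp p1},
    (forall (f : Hp p1) (z : R[i]), unit_disc z ->
      T f z = weighted_comp phi psi f z) /\
    similar_to_isometry T.

(* Main.v *)
(* A single application of W = W_(phi, psi) suffices: similarity to an isometry
   gives ||f|| <= M ||W f|| for all f in H^p. In lowest terms phi = P / Q is
   continuous on the closed disc, and z^n (|P|^2 - |Q|^2) agrees on the circle
   with a polynomial, so either |phi| = 1 on the whole circle and phi is inner,
   or |phi| = 1 only on a finite set. In the second case let g be a nonzero
   polynomial vanishing at the values of phi on that set, and f_k = z^k g.
   The norms ||f_k|| are bounded below, while phi^k g(phi) tends to 0 uniformly
   on the disc, so that ||W f_k|| <= sup |phi^k g(phi)| ||W 1|| tends to 0. The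
   factor g spares any uniform integrability of the means of |psi|^p near the
   contact points. *)
Require Import Defs.
From mathcomp Require Import all_boot all_order all_algebra.
From mathcomp Require Import complex.
From mathcomp Require Import all_classical all_reals all_analysis.
From mathcomp Require Import measurable_realfun.

Set Implicit Arguments.
Unset Strict Implicit.
Unset Printing Implicit Defensive.

Import Order.TTheory GRing.Theory Num.Theory.
Import numFieldNormedType.Exports.

Local Open Scope classical_set_scope.
Local Open Scope ring_scope.
Local Open Scope complex_scope.

Local Notation normc := Normc.normc.

(** * Continuity and differentiability of polynomials, and uniform smallness on the closed disc *)

Lemma normcX (R : realType) (z : R[i]) k : normc (z ^+ k) = normc z ^+ k.
Proof.
elim: k => [|k ih]; first by rewrite !expr0 Normc.normc1.
by rewrite !exprS Normc.normcM ih.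
Qed.

Lemma cisM_conj (R : realType) (t : R) : cis t * (Num.conj (cis t)) = 1.
Proof.
have : `|cis t| = 1 by rewrite Defs.normcE normc_cis.
by move=> h; rewrite -normCK h expr1n.
Qed.

Lemma continuous_polar (R : realType) :
  continuous (fun x : R * R => x.1%:C * cis x.2).
Proof.
move=> x; apply: cvgM; apply: cvg_complex.
- exact: cvg_fst.
- exact: cvg_cst.
- by apply: (continuous_comp (g := cos)); [exact: cvg_snd|exact: continuous_cos].
- by apply: (continuous_comp (g := sin)); [exact: cvg_snd|exact: continuous_sin].
Qed.

Lemma derivable_poly (K : numFieldType) (q : {poly K}) (x : K) :
  derivable (horner q : K -> K^o) x 1.
Proof.
elim/poly_ind: q => [|q c ih].
  rewrite (_ : horner 0 = cst 0); first exact: derivable_cst.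
  by apply/funext => y; rewrite horner0.
rewrite (_ : horner (q * 'X + c%:P) = (fun y => q.[y] * y) + cst c); last first.
  by apply/funext => y; rewrite !hornerE.
by apply: derivableD => //; apply: derivableM.
Qed.

Lemma continuous_poly (R : realType) (q : {poly R[i]}) : continuous (horner q).
Proof.
by move=> x; apply/differentiable_continuous/derivable1_diffP/derivable_poly.
Qed.

Lemma continuous_normc_poly (R : realType) (q : {poly R[i]}) :
  continuous (fun z => normc q.[z]).
Proof. by move=> x; exact: (@cvg_Rnormc _ _ _ _ _ _ (@continuous_poly R q x)). Qed.

Lemma near_unit_disc (R : realType) (z : R[i]) : unit_disc z ->
  \forall w \near z, unit_disc w.
Proof.
rewrite /unit_disc/= => z1; have e0 : 0 < 1 - `|z| by rewrite subr_gt0.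
apply/nbhs_ballP; exists (1 - `|z|) => // w; rewrite /ball/= => zw.
by rewrite -(subrK z w) (le_lt_trans (ler_normD _ _))// -ltrBrDr distrC.
Qed.

Lemma eq_analytic_on_disc (R : realType) (f g : R[i] -> R[i]) :
  (forall z, unit_disc z -> f z = g z) ->
  analytic_on_disc g -> analytic_on_disc f.
Proof.
move=> fg ag z dz; apply: near_eq_derivable (ag z dz).
by apply: filterS (near_unit_disc dz) => w dw; rewrite fg.
Qed.

Lemma analytic_fraction (R : realType) (P Q : {poly R[i]}) :
  (forall z, unit_disc z -> Q.[z] != 0) ->
  analytic_on_disc (fun z => P.[z] / Q.[z]).
Proof.
move=> Q0 z dz; apply: derivableM; first exact: derivable_poly.
by apply: derivableV; [exact: Q0|exact: derivable_poly].
Qed.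

(* Dini's argument: for each point of the compact disc, either [h] or [u ^+ k]
   is uniformly small on a neighbourhood. *)
Lemma dini_closed_disc (R : realType) (u h : R[i] -> R) (e : R) : 0 < e ->
  (forall z, normc z <= 1 -> u x @[x --> z] --> u z) ->
  (forall z, normc z <= 1 -> h x @[x --> z] --> h z) ->
  (forall z, normc z <= 1 -> 0 <= u z <= 1) ->
  (forall z, 0 <= h z) ->
  (forall z, normc z <= 1 -> u z = 1 -> h z = 0) ->
  \forall k \near \oo, forall z, normc z <= 1 -> u z ^+ k * h z < e.
Proof.
move=> e0 cu ch u01 h0 uh.
(* The closed disc is the image of a compact rectangle under polar coordinates, so the covering
   argument takes place on the rectangle. *)
pose pol := fun x : R * R => x.1%:C * cis x.2.
pose K : set (R * R) := `[0, 1]%classic `*` `[0, 2 * pi]%classic.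
have npol x : K x -> normc (pol x) <= 1.
  move=> [x01 _]; have /andP[x0 x1] : 0 <= x.1 <= 1.
    by move: x01; rewrite /= in_itv.
  by rewrite /pol Normc.normcM normc_cis mulr1 normcR.
have cK : compact K by apply: compact_setX; exact: segment_compact.
have /near_covering_withinP ncK := (compact_near_coveringP K).1 cK.
have := ncK nat \oo (fun k x => u (pol x) ^+ k * h (pol x) < e) _.
move=> /(_ _)[].
  move=> x Kx; have px1 := npol x Kx.
  have cpol := @continuous_polar R x.
  have cup : u (pol y) @[y --> x] --> u (pol x).
    exact: (cvg_comp _ _ cpol (cu _ px1)).
  have chp : h (pol y) @[y --> x] --> h (pol x).
    exact: (cvg_comp _ _ cpol (ch _ px1)).
  (* Where [u] is 1, [h] vanishes, hence [h < e] nearby, and the factor [u ^+ k <= 1] does no harm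
     for any [k]. *)
  have [u1|] := eqVneq (u (pol x)) 1.
    have hx : h (pol x) < e by rewrite uh.
    near=> y k => /= Ky.
    have /andP[uy0 uy1] := u01 _ (npol y Ky).
    apply: (@le_lt_trans _ _ (h (pol y))).
      by rewrite ler_piMl// exprn_ile1.
    near: y; exact: (cvgr_lt _ chp _ hx).
  move=> un1; have /andP[ux0 ux1] := u01 _ px1.
  have ux : u (pol x) < 1 by rewrite lt_def eq_sym un1.
  (* Near [x], continuity gives [u < rho < 1] and [h < H], so it is enough that
     [rho ^+ k < e / H]. *)
  pose rho := (u (pol x) + 1) / 2.
  have xrho : u (pol x) < rho by rewrite midf_lt.
  have rho1 : rho < 1 by rewrite midf_lt.
  have rho0 : 0 < rho by rewrite (le_lt_trans ux0).
  pose H := h (pol x) + 1.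
  have xH : h (pol x) < H by rewrite ltrDl.
  have H0 : 0 < H by rewrite (le_lt_trans (h0 (pol x))).
  have /cvgrPdist_lt/(_ (e / H)) : rho ^+ k @[k --> \oo] --> 0.
    by apply: cvg_expr; rewrite ger0_norm ?ltW.
  rewrite divr_gt0// => /(_ isT) rk.
  near=> y k => /= Ky.
  have /andP[uy0 uy1] := u01 _ (npol y Ky).
  apply: (@le_lt_trans _ _ (rho ^+ k * H)).
    apply: ler_pM => //; first exact: exprn_ge0.
      apply: lerXn2r; rewrite ?nnegrE ?(ltW rho0)//.
      apply: ltW; near: y; exact: (cvgr_lt _ cup _ xrho).
    apply: ltW; near: y; exact: (cvgr_lt _ chp _ xH).
  rewrite -ltr_pdivlMr//.
  have : `|0 - rho ^+ k| < e / H by near: k.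
  by rewrite sub0r normrN ger0_norm// exprn_ge0// ltW.
move=> N _ hN; exists N => // k /hN Kk z z1.
have [r [t [r0 t02 zE]]] := polar_surj z.
have r1 : r <= 1 by move: z1; rewrite zE Normc.normcM normc_cis normcR// mulr1.
have := Kk (r, t); rewrite /pol/= -zE; apply; split; rewrite /= in_itv//=.
by rewrite r0.
Unshelve. all: by end_near. Qed.

(** * Rational self-maps of the disc up to the boundary circle *)

Lemma normc_gt0 (R : realType) (z : R[i]) : (0 < normc z) = (z != 0).
Proof.
rewrite lt_def normc_ge0 andbT; congr (~~ _); apply/eqP/eqP.
  exact: Normc.eq0_normc.
by move=> ->; rewrite Normc.normc0.
Qed.

(** For [r < 1] the point [r z] lies in the open disc; both sides are continuous, so the inequality
    survives the limit as [r] tends to 1 from below. *)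
Lemma polynomial_le_closed_disc (R : realType) (P Q : {poly R[i]}) :
  (forall z, unit_disc z -> normc P.[z] <= normc Q.[z]) ->
  forall z, normc z <= 1 -> normc P.[z] <= normc Q.[z].
Proof.
move=> PQ z z1.
have rz : r%:C * z @[r --> (1 : R)^'-] --> z.
  rewrite -[X in _ --> X]mul1r; apply: cvgM; last exact: cvg_cst.
  apply: cvg_at_left_filter; apply: cvg_complex; [exact: cvg_id|exact: cvg_cst].
have c q : normc q.[r%:C * z] @[r --> (1 : R)^'-] --> normc q.[z].
  exact: (cvg_comp _ _ rz (@continuous_normc_poly R q z)).
apply: (ler_cvg_to (c P) (c Q)); near=> r.
apply: PQ; apply/unit_discE.
have r0 : 0 < r by near: r; apply: nbhs_left_gt.
have r1 : r < 1 by near: r; exact: nbhs_left_lt.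
by rewrite Normc.normcM normcR ?(ltW r0)// (le_lt_trans _ r1)// ler_piMr// ltW.
Unshelve. all: by end_near. Qed.

(* A common zero of numerator and denominator on the circle would survive the
   inequality [|P| <= |Q|], so lowest terms leave no pole on the closed disc. *)
Lemma rational_selfmap_closed_disc (R : realType) (phi : R[i] -> R[i]) :
  rational_on_disc phi -> disc_selfmap phi ->
  exists P Q : {poly R[i]},
    [/\ forall z, normc z <= 1 -> Q.[z] != 0,
        forall z, normc z <= 1 -> normc P.[z] <= normc Q.[z] &
        forall z, unit_disc z -> phi z = P.[z] / Q.[z]].
Proof.
move=> [P [Q PQ]] self.
have d0 : unit_disc (0 : R[i]) by rewrite /unit_disc/= normr0 ltr01.
have Q0 : Q != 0.
  by apply/eqP => Q0; have [] := PQ _ d0; rewrite Q0 horner0 eqxx.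
pose D := gcdp P Q; pose P' := P %/ D; pose Q' := Q %/ D.
have PE : P = P' * D by rewrite divpK// dvdp_gcdl.
have QE : Q = Q' * D by rewrite divpK// dvdp_gcdr.
have cop : coprimep P' Q' by apply: coprimep_div_gcd; rewrite Q0 orbT.
have Q'0 z : unit_disc z -> Q'.[z] != 0.
  by move=> /PQ[]; rewrite {1}QE hornerM mulf_eq0 negb_or => /andP[].
have phiE z : unit_disc z -> phi z = P'.[z] / Q'.[z].
  move=> dz; have [Qz ->] := PQ z dz.
  move: Qz; rewrite QE PE !hornerM mulf_eq0 negb_or => /andP[_ Dz].
  by rewrite -mulf_div divff// mulr1.
have le z : normc z <= 1 -> normc P'.[z] <= normc Q'.[z].
  apply: polynomial_le_closed_disc => {}z dz.
  have := self z dz; rewrite phiE// => /unit_discE; rewrite Normc.normcM.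
  rewrite Normc.normcV ltr_pdivrMr ?normc_gt0 ?Q'0// mul1r.
  exact: ltW.
exists P', Q'; split => // z z1; apply/negP => /eqP Qz.
have Pz : P'.[z] = 0.
  apply/Normc.eq0_normc/eqP; rewrite eq_le normc_ge0 andbT.
  by rewrite (le_trans (le z z1))// Qz Normc.normc0.
by have := coprimep_root cop (introT eqP Pz); rewrite Qz eqxx.
Qed.

(** The conjugate reciprocal polynomial [z^(n-1) conj(P(1 / conj z))], for [n] at least the size of
    [P]. *)
Definition reflect_poly (R : realType) n (P : {poly R[i]}) : {poly R[i]} :=
  \poly_(j < n) Num.conj P`_(n.-1 - j).

(** On the circle [conj z] is the inverse of [z], so conjugation turns [z^i] into [z^(-i)], and the
    factor [z^(n-1)] clears the negative powers. *)
Lemma reflect_poly_cis (R : realType) n (P : {poly R[i]}) (t : R) :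
  (size P <= n)%N ->
  (reflect_poly n P).[cis t] = cis t ^+ n.-1 * Num.conj P.[cis t].
Proof.
move=> Pn; rewrite horner_poly (horner_coef_wide _ Pn) rmorph_sum mulr_sumr.
rewrite (reindex_inj rev_ord_inj) /=; apply: eq_bigr => j _.
have jn : (j <= n.-1)%N by case: n Pn j => [|n] _ [].
have -> : (n - j.+1 = n.-1 - j)%N by rewrite -subn1 -subnDA add1n.
rewrite subKn// rmorphM rmorphXn/= mulrCA; congr (_ * _).
by rewrite -[in RHS](subnK jn) exprD -mulrA -exprMn cisM_conj expr1n mulr1.
Qed.

(* On the circle [z ^+ n * (|P z| ^ 2 - |Q z| ^ 2)] is a polynomial in [z]; it
   either vanishes identically or has finitely many zeros. *)
Lemma circle_dichotomy (R : realType) (P Q : {poly R[i]}) :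
  (forall t : R, normc P.[cis t] = normc Q.[cis t]) \/
  exists s : seq R[i], forall t : R, normc P.[cis t] = normc Q.[cis t] -> cis t \in s.
Proof.
(* With a common [n] both reflections carry the same factor [cis t ^+ n.-1], which can be taken out
   of the difference. *)
pose n := maxn (size P) (size Q).
pose F := P * reflect_poly n P - Q * reflect_poly n Q.
have FE t : F.[cis t] =
    cis t ^+ n.-1 * ((normc P.[cis t] ^+ 2)%:C - (normc Q.[cis t] ^+ 2)%:C).
  rewrite /F hornerD hornerN !hornerM !reflect_poly_cis ?leq_maxl ?leq_maxr//.
  rewrite !(mulrCA _ (cis t ^+ _)) -!normCK !Defs.normcE !rmorphXn/=.
  by rewrite mulrBr.
have [F0|F0] := eqVneq F 0.
  left => t; move: (FE t); rewrite F0 horner0 => /esym/eqP.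
  have cis0 : cis t != 0 by rewrite -normc_gt0 normc_cis.
  rewrite mulf_eq0 expf_eq0 (negPf cis0) andbF/= subr_eq0.
  move=> /eqP/complexI/eqP h; apply/eqP.
  by move: h; rewrite eqrXn2 ?normc_ge0.
right; have [s FsE] := closed_field_poly_normal F.
exists s => // t tPQ.
have : root F (cis t) by rewrite /root FE tPQ subrr mulr0.
by rewrite FsE rootZ ?lead_coef_eq0// root_prod_XsubC.
Qed.

(** * Polynomials as elements of the Hardy space, with bounds on their norms *)

Lemma poly_bounded_closed_disc (R : realType) (q : {poly R[i]}) :
  exists2 B : R, 0 <= B & forall z, normc z <= 1 -> normc q.[z] <= B.
Proof.
elim/poly_ind: q => [|q c [B B0 qB]].
  by exists 0 => // z _; rewrite horner0 Normc.normc0.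
exists (B + normc c) => [|z z1]; first by rewrite addr_ge0 ?normc_ge0.
rewrite !hornerE (le_trans (normcD _ _))// lerD2r Normc.normcM.
by rewrite -[leRHS]mulr1 ler_pM ?normc_ge0// qB.
Qed.

(** Truncated to 0 off the disc, as membership in [hardy_pred] demands. *)
Definition disc_poly (R : realType) (q : {poly R[i]}) (z : R[i]) : R[i] :=
  if normc z < 1 then q.[z] else 0.

Lemma disc_polyE (R : realType) (q : {poly R[i]}) (z : R[i]) :
  unit_disc z -> disc_poly q z = q.[z].
Proof. by move=> /unit_discE; rewrite /disc_poly => ->. Qed.

Lemma analytic_disc_poly (R : realType) (q : {poly R[i]}) :
  analytic_on_disc (disc_poly q).
Proof.
apply: (eq_analytic_on_disc (disc_polyE q)) => z _; exact: derivable_poly.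
Qed.

Lemma hardy_mean_le_cst (R : realType) (p B r : R) (f : R[i] -> R[i]) :
  0 <= p -> 0 <= r < 1 -> analytic_on_disc f ->
  (forall z, unit_disc z -> normc (f z) <= B) ->
  (hardy_mean p f r <= (B `^ p)%:E)%E.
Proof.
move=> p0 r01 af fB.
have B0 : 0 <= B.
  by rewrite (le_trans (normc_ge0 _) (fB (r%:C * cis 0) _))//; exact: disc_polar.
have -> : (B `^ p)%:E = (\int[@circle_measure R]_t (cst (B `^ p)%:E t))%E.
  rewrite integral_cst//.
  by rewrite [X in (_ * X)%E](probability_setT (uniform_prob (two_pi_gt0 R))) mule1.
apply: ge0_le_integral => //; [by move=> t _; rewrite lee_fin powR_ge0| |].
  exact: measurable_mean.
move=> t _; rewrite lee_fin ge0_ler_powR ?nnegrE ?normc_ge0//.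
by apply: fB; exact: disc_polar.
Qed.

Lemma disc_poly_hardy (R : realType) (p : R) (p1 : 1 <= p) (q : {poly R[i]}) :
  disc_poly q \in hardy_pred p1.
Proof.
apply/hardy_predP; split; first exact: analytic_disc_poly.
  by move=> z /unit_discE/negP; rewrite /disc_poly => /negPf ->.
have [B B0 qB] := poly_bounded_closed_disc q.
apply: (@le_lt_trans _ _ (B `^ p)%:E); last exact: ltry.
apply: hardy_sup_le => r /andP[r0 r1]; apply: hardy_mean_le_cst.
- exact: le_trans p1.
- by rewrite ltW.
- exact: analytic_disc_poly.
- by move=> z dz; rewrite disc_polyE// qB// ltW//; exact/unit_discE.
Qed.

Definition Hp_poly (R : realType) (p : R) (p1 : 1 <= p) (q : {poly R[i]}) :
  Hp p1 := MkHp (disc_poly_hardy p1 q).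

(** Restricting the integral to [[a, b]] only lowers it; [(2 * pi)^-1] is the density of the uniform
    probability on [[0, 2 * pi]]. *)
Lemma hardy_mean_ge_arc (R : realType) (p a b c r : R) (f : R[i] -> R[i]) :
  0 <= p -> 0 <= r < 1 -> analytic_on_disc f ->
  0 <= a -> a <= b -> b <= 2 * pi -> 0 <= c ->
  (forall t, a <= t <= b -> c <= normc (f (r%:C * cis t))) ->
  (((2 * pi)^-1 * (c `^ p * (b - a)))%:E <= hardy_mean p f r)%E.
Proof.
move=> p0 r01 af a0 ab b2 c0 cf; have mf := measurable_mean p af r01.
rewrite /hardy_mean /circle_measure integral_uniform//; last first.
  by move=> t; rewrite lee_fin powR_ge0.
rewrite subr0 EFinM; apply: lee_wpmul2l.
  by rewrite lee_fin invr_ge0 ltW// two_pi_gt0.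
have sub : `[a, b]%classic `<=` `[0, 2 * pi]%classic.
  move=> t; rewrite /= !in_itv/= => /andP[at_ tb].
  by rewrite (le_trans a0 at_) (le_trans tb b2).
have -> : (c `^ p * (b - a))%:E =
    (\int[@lebesgue_measure R]_(t in `[a, b]) (cst (c `^ p)%:E t))%E.
  rewrite integral_cst//= lebesgue_measure_itv/= lte_fin.
  case: ltP => ab'; first by rewrite -EFinB EFinM.
  by rewrite (@le_anti _ _ a b) ?ab// subrr mulr0 mule0.
apply: (@le_trans _ _ (\int[@lebesgue_measure R]_(t in `[a, b])
    (normc (f (r%:C * cis t)) `^ p)%:E)%E).
  apply: ge0_le_integral => //; [by move=> t _; rewrite lee_fin powR_ge0| |].
    exact: (measurable_funTS mf).
  move=> t; rewrite /= in_itv/= => tab.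
  by rewrite lee_fin ge0_ler_powR ?nnegrE ?normc_ge0// cf.
apply: ge0_subset_integral => //; first exact: (measurable_funTS mf).
by move=> t _; rewrite lee_fin powR_ge0.
Qed.

Lemma poly_neq0_cis (R : realType) (q : {poly R[i]}) : q != 0 ->
  exists2 t : R, 0 < t < 2 * pi & q.[cis t] != 0.
Proof.
move=> q0; apply: contrapT => noq.
(* These angles lie in [[0, pi]], where the cosine is injective, so [size q] of them give distinct
   points of the circle; a nonzero [q] has fewer roots than that. *)
pose u (n : nat) : R := n.+1%:R^-1.
have u01 n : 0 < u n <= 1 by rewrite invr_gt0 ltr0n invf_le1 ?ler1n ?ltr0n.
have pi1 : 1 < pi :> R by rewrite (lt_le_trans _ (pi_ge2 R))// ltr1n.
have u_cis_inj : injective (fun n => cis (u n)).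
  move=> m n [+ _] => /cos_inj.
  have upi k : u k \in `[0, pi].
    by have /andP[? ?] := u01 k; rewrite in_itv/= ltW//= (le_trans _ (ltW pi1)).
  by move=> /(_ (upi m) (upi n)) /invr_inj/eqP; rewrite eqr_nat => /eqP[].
have := @max_poly_roots _ q [seq cis (u n) | n <- iota 0 (size q)] q0.
rewrite size_map size_iota ltnn map_inj_uniq// iota_uniq => /(_ _ isT).
suff -> : all (root q) [seq cis (u n) | n <- iota 0 (size q)] by move/(_ isT).
apply/allP => _ /mapP[n _ ->]; apply/negPn/negP => qn; apply: noq.
exists (u n) => //; have /andP[un0 un1] := u01 n.
by rewrite un0 (le_lt_trans un1)// (lt_trans pi1)// mulr_natl mulr2n ltrDl pi_gt0.
Qed.

(* [|g|] is bounded below on a set [{r e^(it) | 1 - d < r < 1, a <= t <= b}],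
   and [r] can be taken so close to 1 that [r ^+ k >= 1/2]. *)
Lemma hardy_norm_XnM_ge (R : realType) (p : R) (p1 : 1 <= p)
    (g : {poly R[i]}) : g != 0 ->
  exists2 c : R, 0 < c & forall k, c <= hardy_norm p (disc_poly ('X^k * g)).
Proof.
move=> /poly_neq0_cis[a /andP[a0 a2] ga].
have p0 : 0 < p by rewrite (lt_le_trans ltr01).
pose eta := normc g.[cis a] / 2.
have eta0 : 0 < eta by rewrite divr_gt0// normc_gt0.
have : normc g.[x.1%:C * cis x.2] @[x --> ((1 : R), a)] -->
    normc g.[(1 : R)%:C * cis a].
  exact: (cvg_comp _ _ (@continuous_polar R (1, a)) (@continuous_normc_poly R g _)).
move=> /(cvgr_gt _)/(_ eta); rewrite mul1r /eta ltr_pdivrMr//.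
rewrite ltr_pMr ?normc_gt0// ltr1n => /(_ isT) /nbhs_ballP[d /= d0 gd].
(* The half radius keeps [[a, b]] inside the open ball given by continuity; the cap keeps the arc
   within the range of integration. *)
pose b := Num.min (2 * pi) (a + d / 2).
have ab : a < b by rewrite lt_min a2 ltrDl divr_gt0.
(* In [eta / 2] the factor [eta] bounds [|g|] and 1/2 bounds [r ^+ k]. The radius [r] will depend on
   [k], but [m] does not. *)
pose m := (2 * pi)^-1 * ((eta / 2) `^ p * (b - a)).
have m0 : 0 < m.
  rewrite mulr_gt0 ?invr_gt0 ?two_pi_gt0// mulr_gt0 ?subr_gt0//.
  by apply/powR_gt0/divr_gt0.
exists (m `^ p^-1); first exact: powR_gt0.
move=> k; set f := disc_poly _.
have /hardy_predP[af _ ff] := disc_poly_hardy p1 ('X^k * g).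
have [r [r01 rd rk]] : exists r : R, [/\ 0 < r < 1, 1 - d < r & 2^-1 <= r ^+ k].
  have rk : r ^+ k @[r --> (1 : R)^'-] --> (1 : R) ^+ k.
    by apply: cvg_at_left_filter; exact: exprn_continuous.
  near ((1 : R)^'-) => r; exists r; split.
  - apply/andP; split; near: r; [exact: nbhs_left_gt|exact: nbhs_left_lt].
  - by near: r; apply: nbhs_left_gt; rewrite ltrBlDr ltrDl.
  - apply: ltW; near: r; apply: (cvgr_gt _ rk).
    by rewrite expr1n invf_lt1// ltr1n.
case/andP: r01 => r0 r1; have r01 : 0 <= r < 1 by rewrite ltW.
have : (m%:E <= hardy_mean p f r)%E.
  apply: hardy_mean_ge_arc => //.
  - exact: ltW.
  - exact: ltW.
  - exact: ltW.
  - by rewrite /b ge_min lexx.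
  - by rewrite divr_ge0// ltW.
  move=> t /andP[at_ tb].
  rewrite /f disc_polyE; last exact: disc_polar.
  rewrite hornerM hornerXn Normc.normcM normcX Normc.normcM normc_cis mulr1.
  rewrite normcR ?(ltW r0)// mulrC ler_pM ?invr_ge0 ?ler0n ?(ltW eta0)//.
  apply: ltW; have := gd (r, t); apply; split => /=.
    by rewrite /ball/= ger0_norm ?subr_ge0 ?(ltW r1)// ltrBlDr addrC -ltrBlDr.
  rewrite /ball/= distrC ger0_norm ?subr_ge0//.
  rewrite ltrBlDl (le_lt_trans tb)// /b gt_min; apply/orP; right.
  by rewrite ltrD2l ltr_pdivrMr// ltr_pMr// ltr1n.
move=> /le_trans /(_ (hardy_mean_norm p1 ff _)); rewrite r0 => /(_ r1).
rewrite lee_fin => mN.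
have := @ge0_ler_powR _ p^-1 _ m (hardy_norm p f `^ p).
rewrite !nnegrE invr_ge0 (ltW p0) (ltW m0) powR_ge0 => /(_ isT isT isT mN).
by rewrite -powRrM divff ?gt_eqF// powRr1// hardy_norm_ge0.
Unshelve. all: by end_near. Qed.

(** * Norm comparison for the operator and the two cases for the symbol *)

Lemma hardy_norm_dominated (R : realType) (p : R) (p1 : 1 <= p)
    (f g : Hp p1) (e : R) : 0 <= e ->
  (forall z, unit_disc z -> normc (f z) <= e * normc (g z)) ->
  hardy_norm p f <= e * hardy_norm p g.
Proof.
move=> e0 fg; have p0 : 0 <= p by rewrite (le_trans ler01).
apply: hardy_norm_le; rewrite ?mulr_ge0 ?hardy_norm_ge0//.
have /hardy_predP[af _ _] := HpP f.
have /hardy_predP[ag _ gf] := HpP g.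
have aeg : analytic_on_disc (e%:C *: (g : R[i] -> R[i])).
  by move=> z /ag; exact: derivableZ.
move=> r r01; have r01' : 0 <= r < 1 by case/andP: r01 => /ltW ->.
have := hardy_meanZ_le p1 e%:C ag gf r01; rewrite normcR//; apply: le_trans.
apply: ge0_le_integral => //.
- by move=> t _; rewrite lee_fin powR_ge0.
- exact: measurable_mean.
- exact: measurable_mean.
- move=> t _; rewrite lee_fin ge0_ler_powR ?nnegrE ?normc_ge0//.
  have := fg _ (disc_polar t r01').
  by rewrite -[X in _ <= X * _ -> _](normcR e0) -Normc.normcM.
Qed.

(** With [S'] inverse to [S], [|x| <= |B| |S x| = |B| |U (S x)| = |B| |S (T x)| <= |B| |A| |T
    x|]. *)
Lemma similar_to_isometry_ge (K : numFieldType) (X : normedModType K)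
    (T : {linear X -> X}) : similar_to_isometry T ->
  exists2 M : K, 0 <= M & forall x, `|x| <= M * `|T x|.
Proof.
move=> [_ [S [S' [U [[[A SA] [B S'B] [SK S'K]] [isoU TE]]]]]].
(* The bounds [A] and [B] are arbitrary elements of [K]; absolute values make them nonnegative, so
   that they can be multiplied. *)
have bd (V : {linear X -> X}) (C : K) : (forall x, `|V x| <= C * `|x|) ->
    forall x, `|V x| <= `|C| * `|x|.
  move=> VC x; have := VC x; rewrite -[X in _ -> _ <= _ * X]normr_id -normrM.
  by move=> h; rewrite [leRHS]ger0_norm// (le_trans _ h).
exists (`|B| * `|A|); first by rewrite mulr_ge0.
move=> x; rewrite -{1}(SK x) (le_trans (bd _ _ S'B _))// -mulrA ler_wpM2l//.
by rewrite -isoU -(S'K (U (S x))) -TE; exact: bd.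
Qed.

(** Since [Q] has no zero on the circle, [P / Q] is continuous there and the radial limit exists at
    every angle. *)
Lemma inner_of_unimodular (R : realType) (phi : R[i] -> R[i])
    (P Q : {poly R[i]}) :
  disc_selfmap phi ->
  (forall z, normc z <= 1 -> Q.[z] != 0) ->
  (forall z, unit_disc z -> phi z = P.[z] / Q.[z]) ->
  (forall t : R, normc P.[cis t] = normc Q.[cis t]) ->
  inner phi.
Proof.
move=> self Q0 phiE PQ; split => //.
  apply: (eq_analytic_on_disc phiE); apply: analytic_fraction => z.
  by move=> /unit_discE/ltW; exact: Q0.
apply: aeW => t; have Qt : Q.[cis t] != 0 by rewrite Q0// normc_cis.
exists (P.[cis t] / Q.[cis t]); last first.
  by rewrite Defs.normcE Normc.normcM Normc.normcV PQ divff// gt_eqF// normc_gt0.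
have rt : r%:C * cis t @[r --> (1 : R)^'-] --> cis t.
  rewrite -[X in _ --> X]mul1r; apply: cvgM; last exact: cvg_cst.
  apply: cvg_at_left_filter; apply: cvg_complex; [exact: cvg_id|exact: cvg_cst].
have c q : q.[r%:C * cis t] @[r --> (1 : R)^'-] --> q.[cis t].
  exact: (cvg_comp _ _ rt (@continuous_poly R q (cis t))).
apply: cvg_trans (cvgM (c P) (cvgV Qt (c Q))); apply: near_eq_cvg; near=> r.
have r0 : 0 < r by near: r; apply: nbhs_left_gt.
have r1 : r < 1 by near: r; exact: nbhs_left_lt.
by rewrite phiE//; apply: disc_polar; rewrite ltW.
Unshelve. all: by end_near. Qed.

(** This is [dini_closed_disc] for [u = |v|] and [h = |g(v)|] with [v = P / Q]: on the closed disc
    [|v| = 1] occurs only at circle points, and there [g(v)] vanishes. *)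
Lemma fraction_powers_small (R : realType) (P Q g : {poly R[i]}) (e : R) :
  0 < e ->
  (forall z, normc z <= 1 -> Q.[z] != 0) ->
  (forall z, unit_disc z -> normc (P.[z] / Q.[z]) < 1) ->
  (forall t : R, normc P.[cis t] <= normc Q.[cis t]) ->
  (forall t : R, normc P.[cis t] = normc Q.[cis t] ->
     g.[P.[cis t] / Q.[cis t]] = 0) ->
  exists k, forall z, unit_disc z -> normc ('X^k * g).[P.[z] / Q.[z]] <= e.
Proof.
move=> e0 Q0 PQ1 PQle gPQ.
pose v z := P.[z] / Q.[z].
have cv z : normc z <= 1 -> v x @[x --> z] --> v z.
  move=> z1; have c q := @continuous_poly R q z.
  exact: (cvgM (c P) (cvgV (Q0 z z1) (c Q))).
have circle z : normc z <= 1 -> ~ unit_disc z -> exists t : R, z = cis t.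
  have [r [t [r0 t02 ->]]] := polar_surj z; rewrite Normc.normcM normc_cis mulr1.
  rewrite normcR// => r1 dz; exists t.
  suff -> : r = 1 by rewrite mul1r.
  apply/eqP; rewrite eq_le r1 leNgt; apply/negP => r1'.
  by apply: dz; apply: disc_polar; rewrite r0.
have vle z : normc z <= 1 -> normc (v z) <= 1.
  move=> z1; have [dz|/(circle _ z1)[t zt]] := pselect (unit_disc z).
    exact/ltW/PQ1.
  rewrite /v Normc.normcM Normc.normcV ler_pdivrMr ?normc_gt0 ?Q0// mul1r.
  by rewrite zt.
have vg z : normc z <= 1 -> normc (v z) = 1 -> normc g.[v z] = 0.
  move=> z1; have [dz|/(circle _ z1)[t zt]] := pselect (unit_disc z).
    by move=> v1; have := PQ1 z dz; rewrite -/(v z) v1 ltxx.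
  have Qz := Q0 z z1; move: Qz; rewrite zt => Qt.
  rewrite /v Normc.normcM Normc.normcV => /divr1_eq vt.
  by rewrite gPQ// Normc.normc0.
have [N _ HN] : \forall k \near \oo, forall z, normc z <= 1 ->
    normc (v z) ^+ k * normc g.[v z] < e.
  apply: (@dini_closed_disc R (fun z => normc (v z)) (fun z => normc g.[v z])).
  - exact: e0.
  - by move=> z z1; exact: (cvg_Rnormc _ (cv z z1)).
  - move=> z z1.
    exact: (cvg_comp _ _ (cv z z1) (@continuous_normc_poly R g (v z))).
  - by move=> z z1; rewrite normc_ge0 vle.
  - by move=> z; exact: normc_ge0.
  - exact: vg.
exists N => z /unit_discE/ltW z1; apply: ltW.
rewrite hornerM hornerXn Normc.normcM normcX.
exact: (HN N (leqnn N) z z1).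
Qed.

Theorem proposition3p2 (R : realType) (phi psi : R[i] -> R[i])
  (phi_rational : rational_on_disc phi) (phi_self : disc_selfmap phi)
  (psi_analytic : analytic_on_disc psi) :
  (exists (p : R) (p1 : 1 <= p), wcomp_similar_to_isometry p1 phi psi) ->
  inner phi.
Proof.
move=> [p [p1 [T [TE /similar_to_isometry_ge[M M0 TM]]]]].
have [P [Q [Q0 PQ phiE]]] := rational_selfmap_closed_disc phi_rational phi_self.
have [PQ1|[s sPQ]] := circle_dichotomy P Q.
  exact: inner_of_unimodular PQ1.
exfalso.
pose g := \prod_(b <- [seq P.[w] / Q.[w] | w <- s]) ('X - b%:P).
have g0 : g != 0 by apply/monic_neq0/monic_prod_XsubC.
have gPQ t : normc P.[cis t] = normc Q.[cis t] -> g.[P.[cis t] / Q.[cis t]] = 0.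
  move=> /sPQ ts; apply/eqP; rewrite -rootE root_prod_XsubC.
  exact: (map_f (fun w => P.[w] / Q.[w])).
have [c c0 cN] := hardy_norm_XnM_ge p1 g0.
(* On the disc [T one] is [psi], so [T f] is [T one] times the polynomial evaluated at [phi],
   whatever the polynomial defining [f]. *)
pose one : Hp p1 := Hp_poly p1 1.
pose m := normc M.
have m0 : 0 <= m := normc_ge0 M.
have ME : M = m%:C by rewrite -Defs.normcE ger0_norm.
(* As [m * hardy_norm p (T one) <= A < A + 1], the tolerance [c / (A + 1)] will force
   [c <= c * A / (A + 1) < c], also when [m] is 0. *)
pose A := m * (hardy_norm p (T one) + 1).
have A0 : 0 <= A by rewrite mulr_ge0// addr_ge0// hardy_norm_ge0.
have e0 : 0 < c / (A + 1) by rewrite divr_gt0// ltr_wpDl.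
have [k kP] : exists k, forall z, unit_disc z ->
    normc ('X^k * g).[P.[z] / Q.[z]] <= c / (A + 1).
  apply: (fraction_powers_small e0 Q0) => // [z dz|t].
    by rewrite -phiE//; apply/unit_discE; exact: phi_self.
  by apply: PQ; rewrite normc_cis.
pose f : Hp p1 := Hp_poly p1 ('X^k * g).
have Tf : hardy_norm p (T f) <= c / (A + 1) * hardy_norm p (T one).
  apply: hardy_norm_dominated => [|z dz]; first exact: ltW.
  have dphi := phi_self z dz.
  rewrite !TE// /weighted_comp /= !disc_polyE// hornerC mulr1 Normc.normcM.
  by rewrite mulrC ler_wpM2r ?normc_ge0// phiE// kP.
have fM := TM f; rewrite !Hp_normE ME -rmorphM lecR in fM.
have := le_trans (cN k) (le_trans fM (ler_wpM2l m0 Tf)).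
apply/negP; rewrite -ltNge.
have -> : m * (c / (A + 1) * hardy_norm p (T one)) =
    c * (m * hardy_norm p (T one) / (A + 1)).
  by rewrite mulrCA -!mulrA; congr (_ * _); rewrite mulrCA; congr (_ * _); exact: mulrC.
rewrite gtr_pMr// ltr_pdivrMr ?ltr_wpDl// mul1r.
by rewrite ltr_pwDr// ler_wpM2l// lerDl.
Qed.
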